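(* Suppose there exists a vector $M\in\mathbb{R}_+^N$ such that $$\max_{i\in[I]}\max_{x\in Z_1}\left|b_i(x)-a(x)^\top\zeta_i^j\right|\le M_j\qquad\text{for all }j\in[N].$$ Then $Z_1$ is mixed integer representable; precisely, $Z_1$ equals the set of all $x\in\mathbb{R}^n$ for which there exist $\nu,\gamma\in\mathbb{R}$, $z,s\in\mathbb{R}^N$ and $y\in\{0,1\}^N$ such that $$\begin{aligned} &\delta\nu-\epsilon\gamma\le\frac1N\sum_{j\in[N]}z_j,\\ &z_j+\gamma\le s_j,&&\forall j\in[N],\\ &s_j\le b_i(x)-a(x)^\top\zeta_i^j+M_j(1-y_j),&&\forall i\in[I],\ j\in[N],\\ &s_j\le M_jy_j,&&\forall j\in[N],\\ &\|a(x)\|_*\le\nu,\\ &\nu>0,\ \gamma\ge0,\ s_j\ge0,\ z_j\le0,\ y_j\in\{0,1\},&&\forall j\in[N]. \end{aligned}$$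
   Context: Let $n,I,N$ be positive integers, $[R]:=\{1,\dots,R\}$, $\epsilon\in(0,1)$, $\delta>0$. Let $\eta_1,\eta_2\in\{0,1\}$ with $\eta_1+\eta_2\ge1$. For $x\in\mathbb{R}^n$ let $a(x)=\begin{pmatrix}\eta_1x\\ \eta_2\end{pmatrix}\in\mathbb{R}^{n+1}$ and, for $i\in[I]$, $b_i(x)=B_i^\top x+b^i$ with given $B_i\in\mathbb{R}^n$, $b^i\in\mathbb{R}$. Let $\|\cdot\|_*$ be the dual norm on $\mathbb{R}^{n+1}$ of a given norm, and let $\zeta_i^j\in\mathbb{R}^{n+1}$, $i\in[I]$, $j\in[N]$, be given sample vectors. The set $Z_1$ is the set of all $x\in\mathbb{R}^n$ for which there exist $\nu,\gamma\in\mathbb{R}$ and $z\in\mathbb{R}^N$ with $$\begin{aligned} &\delta\nu-\epsilon\gamma\le\frac1N\sum_{j\in[N]}z_j,\\ &z_j+\gamma\le\max\left\{b_i(x)-a(x)^\top\zeta_i^j,\,0\right\},&&\forall i\in[I],\ j\in[N],\\ &z_j\le0,&&\forall j\in[N],\\ &\|a(x)\|_*\le\nu,\\ &\nu>0,\ \gamma\ge0. \end{aligned}$$ *)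

(* Defs.v *)
From mathcomp Require Export all_boot all_order all_algebra.
From mathcomp Require Export all_classical all_reals all_analysis.
Set Implicit Arguments.
Unset Strict Implicit.
Unset Printing Implicit Defensive.
Export Order.TTheory GRing.Theory Num.Theory.

#[local] Open Scope classical_set_scope.
#[local] Open Scope ring_scope.

Definition dotv (R : realType) (m : nat) (u v : 'cV[R]_m) : R :=
  (u^T *m v) 0 0.

(* An arbitrary norm, as a plain function: the canonical norm that the library
   puts on ['cV[R]_m] is the sup norm. *)
Record is_norm (R : realType) (m : nat) (nrm : 'cV[R]_m -> R) : Prop := IsNorm {
  norm_triangle : forall u v, nrm (u + v) <= nrm u + nrm v;
  norm_homogeneous : forall (c : R) u, nrm (c *: u) = `|c| * nrm u;
  norm_definite : forall u, nrm u = 0 -> u = 0 }.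

(* When [nrm] is a norm this set is nonempty and, the dimension being finite,
   bounded, so that [sup] is a genuine supremum. *)
Definition dual_norm (R : realType) (m : nat) (nrm : 'cV[R]_m -> R)
    (u : 'cV[R]_m) : R :=
  sup [set dotv u v | v in [set v | nrm v <= 1]].

Section Sets.
Variables (R : realType) (n I N : nat).
Variables (eps delta eta1 eta2 : R) (nrm : 'cV[R]_(n + 1) -> R).
Variables (B : 'I_I -> 'cV[R]_n) (b0 : 'I_I -> R).
Variable zeta : 'I_I -> 'I_N -> 'cV[R]_(n + 1).

Definition avec (x : 'cV[R]_n) : 'cV[R]_(n + 1) :=
  col_mx (eta1 *: x) (const_mx eta2).

Definition bval (i : 'I_I) (x : 'cV[R]_n) : R := dotv (B i) x + b0 i.

Definition slack (i : 'I_I) (j : 'I_N) (x : 'cV[R]_n) : R :=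
  bval i x - dotv (avec x) (zeta i j).

Definition Z1 : set 'cV[R]_n :=
  [set x | exists (nu gamma : R) (z : 'cV[R]_N),
    delta * nu - eps * gamma <= N%:R^-1 * \sum_(j < N) z j 0 /\
    (forall i j, z j 0 + gamma <= Num.max (slack i j x) 0) /\
    (forall j, z j 0 <= 0) /\
    dual_norm nrm (avec x) <= nu /\
    0 < nu /\ 0 <= gamma].

Definition Z1_mixed_integer (M : 'cV[R]_N) : set 'cV[R]_n :=
  [set x | exists (nu gamma : R) (z s y : 'cV[R]_N),
    delta * nu - eps * gamma <= N%:R^-1 * \sum_(j < N) z j 0 /\
    (forall j, z j 0 + gamma <= s j 0) /\
    (forall i j, s j 0 <= slack i j x + M j 0 * (1 - y j 0)) /\
    (forall j, s j 0 <= M j 0 * y j 0) /\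
    dual_norm nrm (avec x) <= nu /\
    0 < nu /\ 0 <= gamma /\
    (forall j, 0 <= s j 0) /\
    (forall j, z j 0 <= 0) /\
    (forall j, y j 0 = 0 \/ y j 0 = 1)].

End Sets.

(* Main.v *)
Require Import Defs.
#[local] Open Scope classical_set_scope.
#[local] Open Scope ring_scope.

(** For fixed [j], the constraint of [Z1] on [t = z_j + gamma] says that [t] is
    at most every positive part of a slack.  The least of these is the smallest
    slack when it is nonnegative and [0] otherwise, and the binary variable
    [y_j] records which of the two cases holds.

    If all slacks are nonnegative ([y_j = 1]), each positive part is the slack
    itself, so [s_j] can be the positive part of [t], and the bound
    [s_j <= M_j] is implied because slacks are at most [M_j] in absolute value
    on [Z1].  If some slack is negative ([y_j = 0]), then [t <= 0] and [s_j = 0]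
    works: the remaining inequalities [0 <= slack + M_j] hold by the same bound
    on slacks.  This is [big_M_witness].  Conversely, for either value of [y_j]
    the big-M inequalities force [s_j], and with it [t], to be at most every
    positive part: this is [big_M_sound].  The two sets then agree, since the
    other constraints are common to both and the equivalence is applied to each
    [j] separately. *)

(** The minimum of the slacks would also serve for [s], but the positive part
    of [t] avoids forming it.  Nonemptiness of the index type gives
    [s <= m] when [y = 1]. *)
Lemma big_M_witness (R : realType) (T : finType) (i0 : T) (f : T -> R)
    (t m : R) :
    (forall i, `|f i| <= m) -> (forall i, t <= Num.max (f i) 0) ->
  let y : R := ([forall i, 0 <= f i] : bool)%:R in
  let s := Num.max t 0 in
  (forall i, s <= f i + m * (1 - y)) /\ s <= m * y.
Proof.
move=> fm tf /=; have [/forallP f0|] := boolP [forall i, 0 <= f i].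
  have sf i : Num.max t 0 <= f i.
    by rewrite ge_max f0 andbT; have := tf i; rewrite (max_l (f0 i)).
  rewrite subrr mulr0 mulr1; split=> [i|]; first by rewrite addr0.
  exact: le_trans (sf i0) (le_trans (ler_norm _) (fm i0)).
rewrite negb_forall => /existsP[k]; rewrite -ltNge => /ltW fk0.
have t0 : t <= 0 by have := tf k; rewrite (max_r fk0).
rewrite (max_r t0) subr0 mulr1 mulr0; split=> // i.
by rewrite -lerBlDr sub0r; have := fm i; rewrite ler_norml => /andP[].
Qed.

Lemma big_M_sound (R : realType) (f s m y : R) :
    y = 0 \/ y = 1 -> s <= f + m * (1 - y) -> s <= m * y ->
  s <= Num.max f 0.
Proof.
case=> ->; rewrite le_max.
  by rewrite mulr0 => _ ->; rewrite orbT.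
by rewrite subrr mulr0 addr0 => ->.
Qed.

Lemma le_of_bigmax_ereal_sup (R : realType) (T : finType) (X : Type)
    (A : set X) (g : T -> X -> R) (m : R) :
    (\big[maxe/-oo]_i ereal_sup [set (g i x)%:E | x in A] <= m%:E)%E ->
  forall i x, A x -> g i x <= m.
Proof.
move=> gm i x Ax; rewrite -lee_fin; apply: le_trans gm.
apply: le_trans (le_bigmax _ _ i).
by apply: ereal_sup_ubound; exists x.
Qed.

Theorem theorem2 (R : realType) (n I N : nat)
    (n_gt0 : (0 < n)%N) (I_gt0 : (0 < I)%N) (N_gt0 : (0 < N)%N)
    (eps delta : R) (eps_gt0 : 0 < eps) (eps_lt1 : eps < 1)
    (delta_gt0 : 0 < delta)
    (eta1 eta2 : R) (eta1_01 : eta1 = 0 \/ eta1 = 1)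
    (eta2_01 : eta2 = 0 \/ eta2 = 1) (eta_ge1 : 1 <= eta1 + eta2)
    (nrm : 'cV[R]_(n + 1) -> R) (nrm_norm : is_norm nrm)
    (B : 'I_I -> 'cV[R]_n) (b0 : 'I_I -> R)
    (zeta : 'I_I -> 'I_N -> 'cV[R]_(n + 1))
    (M : 'cV[R]_N) (M_ge0 : forall j, 0 <= M j 0)
    (M_bound : forall j : 'I_N,
      (\big[maxe/-oo]_(i < I)
         ereal_sup [set (`|slack eta1 eta2 B b0 zeta i j x|)%:E
                   | x in Z1 eps delta eta1 eta2 nrm B b0 zeta]
       <= (M j 0)%:E)%E) :
  Z1 eps delta eta1 eta2 nrm B b0 zeta
  = Z1_mixed_integer eps delta eta1 eta2 nrm B b0 zeta M.
Proof.
apply/seteqP; split=> x.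
- move=> Zx; have [nu [gamma [z [zsum [zslack [z0 [dual [nu0 gamma0]]]]]]]] := Zx.
  pose f j i := slack eta1 eta2 B b0 zeta i j x.
  have W j := big_M_witness _ _ (Ordinal I_gt0) (f j) (z j 0 + gamma) (M j 0)
    (fun i => le_of_bigmax_ereal_sup _ _ _ _ _ _ (M_bound j) i x Zx) (fun i => zslack i j).
  exists nu, gamma, z, (\col_j Num.max (z j 0 + gamma) 0),
    (\col_j ([forall i, 0 <= f j i] : bool)%:R).
  do !split=> //.
  + by move=> j; rewrite mxE le_max lexx.
  + by move=> i j; rewrite !mxE; apply: (W j).1.
  + by move=> j; rewrite !mxE; apply: (W j).2.
  + by move=> j; rewrite mxE le_max lexx orbT.
  + by move=> j; rewrite mxE; case: [forall i, _]; [right|left].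
- move=> [nu [gamma [z [s [y [zsum [zs [sslack [sM [dual [nu0 [gamma0 [_ [z0 y01]]]]]]]]]]]]]].
  exists nu, gamma, z; do !split=> //; move=> i j.
  exact: le_trans (zs j) (big_M_sound _ _ _ _ _ (y01 j) (sslack i j) (sM j)).
Qed.
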